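(* Let $n\ge 2$ be an integer and let $\Phi$ be a real $N\times d$ matrix satisfying the Restricted Isometry Condition with parameters $(8n,\varepsilon)$ for $\varepsilon=0.01/\sqrt{\log n}$. Let $v\in\mathbb{R}^d$ be an arbitrary vector, let $e\in\mathbb{R}^N$ be an arbitrary vector, let $x=\Phi v+e$ be the measurement vector, and let $\hat v$ be the reconstructed vector output by ROMP with measurement matrix $\Phi$, measurement vector $x$ and sparsity level $2n$. Then $$\|v_{2n}-\hat v_{2n}\|_2\le 477\sqrt{\log (2n)}\,\Big(\|e\|_2+\frac{\|v-v_n\|_1}{\sqrt n}\Big).$$
   Context: $\log$ is the natural logarithm. For $z\in\mathbb{R}^d$, $z_m$ denotes the best $m$-sparse approximation to $z$, i.e. the vector consisting of the largest $m$ coordinates of $z$ in absolute value (the other coordinates are set to zero; ties broken arbitrarily); in particular $\hat v_{2n}=(\hat v)_{2n}$. A vector is $m$-sparse if it has at most $m$ nonzero coordinates. For $I\subset\{1,\dots,d\}$, $v|_I$ denotes the restriction of $v$ to the coordinates in $I$ (extended by zero outside $I$), and $\mathbb{R}^I$ is identified with the vectors of $\mathbb{R}^d$ supported in $I$. Restricted Isometry Condition (RIC): a real $N\times d$ matrix $\Phi$ satisfies the RIC with parameters $(m,\varepsilon)$, $\varepsilon\in(0,1)$, if $(1-\varepsilon)\|v\|_2\le\|\Phi v\|_2\le(1+\varepsilon)\|v\|_2$ for all $m$-sparse vectors $v\in\mathbb{R}^d$. Regularized Orthogonal Matching Pursuit (ROMP) with matrix $\Phi$, measurement vector $x\in\mathbb{R}^N$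 and sparsity level $s$: Initialize the index set $I=\emptyset$ and the residual $r=x$ (with $y=0$). Repeat the following steps $s$ times or until $|I|\ge 2s$ (whichever comes first). Identify: choose a set $J$ of the $s$ biggest nonzero coordinates in magnitude of the observation vector $u=\Phi^*r$, or all of its nonzero coordinates, whichever set is smaller. Regularize: among all subsets $J_0\subset J$ with comparable coordinates, i.e. $|u(i)|\le 2|u(j)|$ for all $i,j\in J_0$, choose $J_0$ with the maximal energy $\|u|_{J_0}\|_2$. Update: replace $I$ by $I\cup J_0$, and then set $y=\arg\min_{z\in\mathbb{R}^I}\|x-\Phi z\|_2$ and $r=x-\Phi y$. Output: the index set $I$ and the reconstructed vector $\hat v=y$. Ties are broken arbitrarily. *)

(* Defs.v *)
From mathcomp Require Import all_boot all_order all_algebra.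
From mathcomp Require Import reals exp.

Set Implicit Arguments.
Unset Strict Implicit.
Unset Printing Implicit Defensive.

Import Order.TTheory GRing.Theory Num.Theory.
Local Open Scope ring_scope.

(* The library norm on matrices is the sup norm, hence these definitions. *)
Definition l2norm (R : realType) (d : nat) (v : 'cV[R]_d) : R :=
  Num.sqrt (\sum_i v i 0 ^+ 2).

Definition l1norm (R : realType) (d : nat) (v : 'cV[R]_d) : R :=
  \sum_i `|v i 0|.

Definition supp (R : realType) (d : nat) (v : 'cV[R]_d) : {set 'I_d} :=
  [set i | v i 0 != 0].

Definition sparse (R : realType) (d m : nat) (v : 'cV[R]_d) : bool :=
  (#|supp v| <= m)%N.

Definition restr (R : realType) (d : nat) (A : {set 'I_d}) (v : 'cV[R]_d) :
    'cV[R]_d :=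
  \col_i (if i \in A then v i 0 else 0).

(* Constructions that depend on tie-breaking are relations, satisfied by every
   admissible choice. [is_largest m u A S]: S consists of m largest (in
   magnitude) coordinates of u among those in A, or of all of A if #|A| < m. *)
Definition is_largest (R : realType) (d m : nat) (u : 'cV[R]_d)
    (A S : {set 'I_d}) : Prop :=
  [/\ S \subset A, #|S| = minn m #|A| &
      forall i j, i \in S -> j \in A :\: S -> `|u j 0| <= `|u i 0|].

(* w is a choice of the best m-sparse approximation z_m. *)
Definition is_best_sparse (R : realType) (d m : nat) (z w : 'cV[R]_d) : Prop :=
  exists2 S : {set 'I_d}, is_largest m z [set: 'I_d] S & w = restr S z.

Definition RIC (R : realType) (N d : nat) (Phi : 'M[R]_(N, d)) (m : nat)
    (eps : R) : Prop :=
  0 < eps < 1 /\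
  forall v : 'cV[R]_d, sparse m v ->
    (1 - eps) * l2norm v <= l2norm (Phi *m v) <= (1 + eps) * l2norm v.

Definition romp_identify (R : realType) (d s : nat) (u : 'cV[R]_d)
    (J : {set 'I_d}) : Prop :=
  is_largest s u (supp u) J.

Definition comparable_coords (R : realType) (d : nat) (u : 'cV[R]_d)
    (A : {set 'I_d}) : Prop :=
  forall i j, i \in A -> j \in A -> `|u i 0| <= 2 * `|u j 0|.

Definition romp_regularize (R : realType) (d : nat) (u : 'cV[R]_d)
    (J J0 : {set 'I_d}) : Prop :=
  [/\ J0 \subset J, comparable_coords u J0 &
      forall K : {set 'I_d}, K \subset J -> comparable_coords u K ->
        l2norm (restr K u) <= l2norm (restr J0 u)].

Definition is_least_squares (R : realType) (N d : nat) (Phi : 'M[R]_(N, d))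
    (x : 'cV[R]_N) (I : {set 'I_d}) (y : 'cV[R]_d) : Prop :=
  supp y \subset I /\
  forall z : 'cV[R]_d, supp z \subset I ->
    l2norm (x - Phi *m y) <= l2norm (x - Phi *m z).

(* [romp_state Phi x s k I y r]: after k iterations, some run of ROMP has index
   set I, current estimate y and residual r. *)
Inductive romp_state (R : realType) (N d : nat) (Phi : 'M[R]_(N, d))
    (x : 'cV[R]_N) (s : nat) :
    nat -> {set 'I_d} -> 'cV[R]_d -> 'cV[R]_N -> Prop :=
| Romp_init : romp_state Phi x s 0 set0 0 x
| Romp_step (k : nat) (I J J0 : {set 'I_d}) (y y' : 'cV[R]_d)
    (r : 'cV[R]_N) :
    romp_state Phi x s k I y r ->
    (k < s)%N -> (#|I| < 2 * s)%N ->
    romp_identify s (Phi^T *m r) J ->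
    romp_regularize (Phi^T *m r) J J0 ->
    is_least_squares Phi x (I :|: J0) y' ->
    romp_state Phi x s k.+1 (I :|: J0) y' (x - Phi *m y').

Definition romp_output (R : realType) (N d : nat) (Phi : 'M[R]_(N, d))
    (x : 'cV[R]_N) (s : nat) (I : {set 'I_d}) (vhat : 'cV[R]_d) : Prop :=
  exists (k : nat) (r : 'cV[R]_N),
    romp_state Phi x s k I vhat r /\ (k = s \/ (2 * s <= #|I|)%N).

(* Main.v *)
Require Import Defs.
From mathcomp Require Import all_boot all_order all_algebra.
From mathcomp Require Import ring lra zify.
From mathcomp Require Import reals sequences exp.
Set Implicit Arguments.
Unset Strict Implicit.
Unset Printing Implicit Defensive.
Import Order.TTheory GRing.Theory Num.Theory.
Local Open Scope ring_scope.

(** Write [s = 2 * n], [w] for the best [s]-sparse approximation of [v], and [x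
    = Phi w + e'], so that the noise [e'] is [e] plus the image of the tail [v
    - w].

    Consider a stage of the pursuit with index set [I], estimate [y] and
    observation [u = Phi^T (x - Phi y)], and put [h = w - y]. On any set of few
    coordinates, [u] agrees with [h] up to [eta = (2 eps + eps^2) |h| + (1 +
    eps) |e'|] ([observation_local]). As [y] is a least squares solution, [u]
    vanishes on [I]. Hence [h] is small on [I], while off [I] it coincides with
    [w]; so [|h|] is essentially the norm of the part of [w] missing from [I]
    ([error_le_missing]).

    Now let [J0] be the regularized selection. Splitting the identified set [J]
    into dyadic levels shows that [u] has on [J0] its norm on [J] up to a
    factor [2 sqrt (ln s)] ([regularize_energy], [log_number_of_blocks]), and
    the norm on [J] is at least that of [u] on the missing part of the support.
    If no strict majority of [J0] lay in the support of [w], comparability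
    would place a fixed fraction of its energy on coordinates where [h = 0], so
    the norm of [u] on [J0] would be at most of the order of [eta]. Since [eps
    sqrt (ln s)] is small, this forces the missing part of [w] to be at most [8
    sqrt (ln s) |e'|] ([missing_part_small]). So at every iteration either this
    bound holds, and then it persists, or strictly more than half of the new
    indices are correct. In the second case the support of [w] is exhausted
    after [s] iterations or once [2 s] indices are selected ([romp_invariant]).
    Either way [|w - vhat| <= 10 sqrt (ln s) |e'|] ([romp_error]).

    The image of the tail is bounded by cutting [v - w] into blocks of
    decreasing coordinates ([RIC_bounded]), which gives [2 (1 + eps)] times the
    [l1] norm of [v - v_n] over [sqrt n]. Passing from [vhat] to its best
    [s]-sparse approximation at most doubles the distance to [w], and [2 * 10 *
    2.04 < 477]. *)

(** * Euclidean geometry of column vectors *)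

Definition dotv (R : realType) (d : nat) (a b : 'cV[R]_d) : R :=
  \sum_i a i 0 * b i 0.

Lemma dotvE (R : realType) (d : nat) (a b : 'cV[R]_d) :
  dotv a b = (a^T *m b) 0 0.
Proof. by rewrite mxE; apply: eq_bigr => i _; rewrite mxE. Qed.

Lemma dotvC (R : realType) (d : nat) (a b : 'cV[R]_d) : dotv a b = dotv b a.
Proof. by apply: eq_bigr => i _; rewrite mulrC. Qed.

Lemma dotvDr (R : realType) (d : nat) (a b c : 'cV[R]_d) :
  dotv a (b + c) = dotv a b + dotv a c.
Proof. by rewrite !dotvE mulmxDr mxE. Qed.

Lemma dotvZr (R : realType) (d : nat) (t : R) (a b : 'cV[R]_d) :
  dotv a (t *: b) = t * dotv a b.
Proof. by rewrite !dotvE -scalemxAr mxE. Qed.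

Lemma dotvDl (R : realType) (d : nat) (a b c : 'cV[R]_d) :
  dotv (b + c) a = dotv b a + dotv c a.
Proof. by rewrite dotvC dotvDr !(dotvC a). Qed.

Lemma dotvZl (R : realType) (d : nat) (t : R) (a b : 'cV[R]_d) :
  dotv (t *: b) a = t * dotv b a.
Proof. by rewrite dotvC dotvZr dotvC. Qed.

Lemma dotvBl (R : realType) (d : nat) (a b c : 'cV[R]_d) :
  dotv (b - c) a = dotv b a - dotv c a.
Proof. by rewrite -scaleN1r dotvDl dotvZl mulN1r. Qed.

Lemma dotvBr (R : realType) (d : nat) (a b c : 'cV[R]_d) :
  dotv a (b - c) = dotv a b - dotv a c.
Proof. by rewrite dotvC dotvBl !(dotvC a). Qed.

Lemma dotv_adj (R : realType) (N d : nat) (Phi : 'M[R]_(N, d))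
    (r : 'cV[R]_N) (g : 'cV[R]_d) :
  dotv (Phi^T *m r) g = dotv r (Phi *m g).
Proof. by rewrite !dotvE trmx_mul trmxK mulmxA. Qed.

Lemma l2norm_ge0 (R : realType) (d : nat) (a : 'cV[R]_d) : 0 <= l2norm a.
Proof. exact: sqrtr_ge0. Qed.

Lemma l2norm_sqr (R : realType) (d : nat) (a : 'cV[R]_d) :
  l2norm a ^+ 2 = dotv a a.
Proof.
rewrite sqr_sqrtr; first by apply: eq_bigr => i _; rewrite expr2.
by apply: sumr_ge0 => i _; apply: sqr_ge0.
Qed.

Lemma dotvv_ge0 (R : realType) (d : nat) (a : 'cV[R]_d) : 0 <= dotv a a.
Proof. by rewrite -l2norm_sqr sqr_ge0. Qed.

Lemma l2norm_le (R : realType) (d d' : nat) (a : 'cV[R]_d) (b : 'cV[R]_d') :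
  (l2norm a <= l2norm b) = (l2norm a ^+ 2 <= l2norm b ^+ 2).
Proof. by rewrite ler_sqr // nnegrE l2norm_ge0. Qed.

Lemma l2normZ (R : realType) (d : nat) (t : R) (a : 'cV[R]_d) :
  0 <= t -> l2norm (t *: a) = t * l2norm a.
Proof.
move=> t0; apply/eqP.
rewrite -(eqrXn2 (n := 2)) ?mulr_ge0 ?l2norm_ge0 //.
by rewrite exprMn !l2norm_sqr dotvZl dotvZr mulrA expr2.
Qed.

Lemma l2normN (R : realType) (d : nat) (a : 'cV[R]_d) :
  l2norm (- a) = l2norm a.
Proof.
by congr Num.sqrt; apply: eq_bigr => i _; rewrite mxE sqrrN.
Qed.

Lemma l2norm0 (R : realType) (d : nat) : l2norm (0 : 'cV[R]_d) = 0.
Proof. by rewrite -(scale0r (0 : 'cV[R]_d)) l2normZ // mul0r. Qed.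

Lemma l2norm_eq0 (R : realType) (d : nat) (a : 'cV[R]_d) :
  l2norm a = 0 -> a = 0.
Proof.
move=> a0; have : dotv a a == 0 by rewrite -l2norm_sqr a0 expr0n.
rewrite psumr_eq0; last by move=> i _; rewrite -expr2 sqr_ge0.
move/allP=> h; apply/colP => i; rewrite mxE; apply/eqP.
by have := h i (mem_index_enum _); rewrite -expr2 sqrf_eq0.
Qed.

(** Homogeneity upgrades an additive bound by squared norms to the sharp
    product bound: rescale both arguments to the common norm [|a| |b|]. This
    yields both the Cauchy-Schwarz inequality and the near-orthogonality that a
    restricted isometry preserves. *)
Lemma bilinear_bound (R : realType) (d : nat) (f : 'cV[R]_d -> 'cV[R]_d -> R)
    (c : R) (a b : 'cV[R]_d) :
  (forall s t, f (s *: a) (t *: b) = s * t * f a b) ->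
  (forall s t, f (s *: a) (t *: b) <=
     c / 2 * (l2norm (s *: a) ^+ 2 + l2norm (t *: b) ^+ 2)) ->
  f a b <= c * l2norm a * l2norm b.
Proof.
move=> fZ fle.
have [a0|an0] := eqVneq (l2norm a) 0.
  by rewrite a0 mulr0 mul0r (l2norm_eq0 a0) -(scale0r 0) -(scale1r b)
    -(l2norm_eq0 a0) fZ mul0r mul0r.
have [b0|bn0] := eqVneq (l2norm b) 0.
  by rewrite b0 mulr0 (l2norm_eq0 b0) -(scale0r 0) -(scale1r a)
    -(l2norm_eq0 b0) fZ mulr0 mul0r.
have apos : 0 < l2norm a by rewrite lt0r an0 l2norm_ge0.
have bpos : 0 < l2norm b by rewrite lt0r bn0 l2norm_ge0.
have := fle (l2norm b) (l2norm a).
rewrite fZ !l2normZ ?l2norm_ge0 // => h.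
have p : 0 < l2norm b * l2norm a by apply: mulr_gt0.
rewrite -(ler_pM2l p); apply: (le_trans h).
by rewrite le_eqVlt; apply/orP; left; apply/eqP; field.
Qed.

Lemma cauchy_schwarz (R : realType) (d : nat) (a b : 'cV[R]_d) :
  dotv a b <= l2norm a * l2norm b.
Proof.
rewrite -[l2norm a]mul1r; apply: bilinear_bound => s t.
  by rewrite dotvZl dotvZr mulrA.
have := dotvv_ge0 (s *: a - t *: b).
rewrite dotvBl !dotvBr (dotvC (t *: b) (s *: a)) -!l2norm_sqr.
set x := dotv _ _; set y := l2norm _ ^+ 2; set z := l2norm _ ^+ 2; lra.
Qed.

Lemma l2norm_triangle (R : realType) (d : nat) (a b : 'cV[R]_d) :
  l2norm (a + b) <= l2norm a + l2norm b.
Proof.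
rewrite -ler_sqr ?nnegrE ?addr_ge0 ?l2norm_ge0 //.
rewrite l2norm_sqr dotvDl !dotvDr sqrrD !l2norm_sqr (dotvC b a).
have := cauchy_schwarz a b; set x := dotv _ _; set y := dotv a a.
by set z := dotv b b; lra.
Qed.

Lemma l2norm_triangleB (R : realType) (d : nat) (a b : 'cV[R]_d) :
  l2norm (a - b) <= l2norm a + l2norm b.
Proof. by rewrite -(l2normN b) l2norm_triangle. Qed.

(** * Restriction to a set of coordinates *)

Lemma supp_restr (R : realType) (d : nat) (A : {set 'I_d}) (a : 'cV[R]_d) :
  supp (restr A a) \subset A.
Proof.
by apply/subsetP => i; rewrite inE mxE; case: ifP => // _; rewrite eqxx.
Qed.

Lemma notin_supp (R : realType) (d : nat) (A : {set 'I_d}) (a : 'cV[R]_d) i :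
  supp a \subset A -> i \notin A -> a i 0 = 0.
Proof.
move=> aA iA; apply/eqP; apply: contraNT iA => ai.
by apply: (subsetP aA); rewrite inE.
Qed.

Lemma sqr_l2norm_restr (R : realType) (d : nat) (A : {set 'I_d})
    (a : 'cV[R]_d) :
  l2norm (restr A a) ^+ 2 = \sum_(i in A) a i 0 ^+ 2.
Proof.
rewrite l2norm_sqr [RHS]big_mkcond; apply: eq_bigr => i _; rewrite mxE.
by case: ifP => _; rewrite ?mulr0 ?expr2.
Qed.

Lemma dotv_restr (R : realType) (d : nat) (A : {set 'I_d}) (a : 'cV[R]_d) :
  dotv a (restr A a) = l2norm (restr A a) ^+ 2.
Proof.
rewrite l2norm_sqr; apply: eq_bigr => i _; rewrite mxE.
by case: ifP => _; rewrite ?mulr0.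
Qed.

Lemma restrB (R : realType) (d : nat) (A : {set 'I_d}) (a b : 'cV[R]_d) :
  restr A (a - b) = restr A a - restr A b.
Proof.
apply/colP => i; rewrite !mxE; case: ifP => _; first by [].
by rewrite subr0.
Qed.

Lemma restr_eq (R : realType) (d : nat) (A : {set 'I_d}) (a b : 'cV[R]_d) :
  (forall i, i \in A -> a i 0 = b i 0) -> restr A a = restr A b.
Proof. by move=> h; apply/colP => i; rewrite !mxE; case: ifP => // /h. Qed.

Lemma l2norm_restr_subset (R : realType) (d : nat) (A B : {set 'I_d})
    (a : 'cV[R]_d) :
  A \subset B -> l2norm (restr A a) <= l2norm (restr B a).
Proof.
move=> AB; rewrite l2norm_le !sqr_l2norm_restr.
rewrite [X in _ <= X](big_setID A) /= (setIidPr AB) lerDl.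
by apply: sumr_ge0 => i _; apply: sqr_ge0.
Qed.

Lemma restrT (R : realType) (d : nat) (a : 'cV[R]_d) : restr setT a = a.
Proof. by apply/colP => i; rewrite !mxE inE. Qed.

Lemma l2norm_restr_le (R : realType) (d : nat) (A : {set 'I_d})
    (a : 'cV[R]_d) :
  l2norm (restr A a) <= l2norm a.
Proof. by rewrite -{2}(restrT a) l2norm_restr_subset ?subsetT. Qed.

Lemma restr_subC (R : realType) (d : nat) (A : {set 'I_d}) (a : 'cV[R]_d) :
  a - restr A a = restr (~: A) a.
Proof.
apply/colP => i; rewrite !mxE !inE; case: ifP => _ /=; first by rewrite subrr.
by rewrite subr0.
Qed.

Lemma restr_splitC (R : realType) (d : nat) (A : {set 'I_d}) (a : 'cV[R]_d) :
  a = restr A a + restr (~: A) a.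
Proof. by rewrite -restr_subC addrC subrK. Qed.

Lemma subset_sparse (R : realType) (d m : nat) (D : {set 'I_d})
    (a : 'cV[R]_d) :
  supp a \subset D -> (#|D| <= m)%N -> sparse m a.
Proof. by move=> aD; apply: leq_trans; apply: subset_leq_card. Qed.

Lemma suppD (R : realType) (d : nat) (D : {set 'I_d}) (a b : 'cV[R]_d) :
  supp a \subset D -> supp b \subset D -> supp (a + b) \subset D.
Proof.
move=> aD bD; apply/subsetP => i; rewrite inE mxE; apply: contraR => iD.
by rewrite (notin_supp aD iD) (notin_supp bD iD) addr0.
Qed.

Lemma suppZ (R : realType) (d : nat) (D : {set 'I_d}) (t : R) (a : 'cV[R]_d) :
  supp a \subset D -> supp (t *: a) \subset D.
Proof.
move=> aD; apply/subsetP => i; rewrite inE mxE; apply: contraR => iD.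
by rewrite (notin_supp aD iD) mulr0.
Qed.

Lemma suppB (R : realType) (d : nat) (D : {set 'I_d}) (a b : 'cV[R]_d) :
  supp a \subset D -> supp b \subset D -> supp (a - b) \subset D.
Proof. by move=> aD bD; rewrite -scaleN1r suppD ?suppZ. Qed.

(** * Restricted isometries and least squares *)

Lemma RIC_sqr (R : realType) (N d m : nat) (Phi : 'M[R]_(N, d)) (eps : R)
    (a : 'cV[R]_d) :
  RIC Phi m eps -> sparse m a ->
  `|l2norm (Phi *m a) ^+ 2 - l2norm a ^+ 2|
    <= (2 * eps + eps ^+ 2) * l2norm a ^+ 2.
Proof.
case=> /andP[e0 e1] hPhi /hPhi /andP[hl hr].
have na := l2norm_ge0 a; have nP := l2norm_ge0 (Phi *m a).
have h1 : l2norm (Phi *m a) ^+ 2 <= ((1 + eps) * l2norm a) ^+ 2.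
  by rewrite ler_sqr // nnegrE mulr_ge0 //; lra.
have h2 : ((1 - eps) * l2norm a) ^+ 2 <= l2norm (Phi *m a) ^+ 2.
  by rewrite ler_sqr // nnegrE mulr_ge0 //; lra.
have h3 : 0 <= eps ^+ 2 * l2norm a ^+ 2 by rewrite mulr_ge0 ?sqr_ge0.
rewrite !exprMn in h1 h2.
by rewrite ler_norml; apply/andP; split; lra.
Qed.

(** Polarization turns the near-isometry on sums and differences of [a] and
    [b] into near-preservation of their inner product. *)
Lemma RIC_dotv (R : realType) (N d m : nat) (Phi : 'M[R]_(N, d)) (eps : R)
    (D : {set 'I_d}) (a b : 'cV[R]_d) :
  RIC Phi m eps -> (#|D| <= m)%N -> supp a \subset D -> supp b \subset D ->
  dotv (Phi *m a) (Phi *m b) - dotv a b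
    <= (2 * eps + eps ^+ 2) * l2norm a * l2norm b.
Proof.
move=> hPhi Dm aD bD.
pose f x y := dotv (Phi *m x) (Phi *m y) - dotv x y.
rewrite -[X in X <= _]/(f a b); apply: bilinear_bound => s t.
  rewrite /f -!scalemxAr !dotvZl !dotvZr; ring.
have := RIC_sqr hPhi (subset_sparse (suppD (suppZ s aD) (suppZ t bD)) Dm).
have := RIC_sqr hPhi (subset_sparse (suppB (suppZ s aD) (suppZ t bD)) Dm).
rewrite !ler_norml => /andP[h _] /andP[_ h']; move: h h'.
rewrite /f mulmxBr mulmxDr !l2norm_sqr.
rewrite !dotvBl !dotvBr !dotvDl !dotvDr.
rewrite (dotvC (t *: b) (s *: a)) (dotvC (Phi *m (t *: b))).
set c := 2 * eps + eps ^+ 2; lra.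
Qed.

(** The observation [Phi^T r] of the residual of [h] agrees with [h] itself on
    every small set of coordinates: testing against the restricted error
    reduces this to the preservation of inner products. *)
Lemma observation_local (R : realType) (N d m : nat) (Phi : 'M[R]_(N, d))
    (eps : R) (A D : {set 'I_d}) (h : 'cV[R]_d) (e : 'cV[R]_N) :
  RIC Phi m eps -> (#|D| <= m)%N -> supp h \subset D -> A \subset D ->
  l2norm (restr A (Phi^T *m (Phi *m h + e) - h))
    <= (2 * eps + eps ^+ 2) * l2norm h + (1 + eps) * l2norm e.
Proof.
move=> hPhi Dm hD AD; set u := _ - h; set g := restr A u.
have gD : supp g \subset D := subset_trans (supp_restr A u) AD.
have [/andP[e0 e1] hP] := hPhi.
have /andP[_ Phig] := hP g (subset_sparse gD Dm).
have nh := l2norm_ge0 h; have ne := l2norm_ge0 e; have ng := l2norm_ge0 g.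
have [g0|gn0] := eqVneq (l2norm g) 0.
  by rewrite g0; have := sqr_ge0 eps => ?; rewrite addr_ge0 ?mulr_ge0 //; lra.
have gpos : 0 < l2norm g by rewrite lt0r gn0.
rewrite -(ler_pM2r gpos) -expr2 -dotv_restr -/g.
rewrite dotvBl dotv_adj dotvDl.
have h1 := RIC_dotv hPhi Dm hD gD.
have h2 : dotv e (Phi *m g) <= l2norm e * ((1 + eps) * l2norm g).
  by apply: le_trans (cauchy_schwarz _ _) _; apply: ler_wpM2l.
by move: h1 h2; set c := 2 * eps + _; lra.
Qed.

Lemma sqr_l2normBZ (R : realType) (d : nat) (t : R) (a b : 'cV[R]_d) :
  l2norm (a - t *: b) ^+ 2
    = l2norm a ^+ 2 - 2 * t * dotv a b + t ^+ 2 * l2norm b ^+ 2.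
Proof.
rewrite !l2norm_sqr !dotvBl !dotvBr !dotvZl !dotvZr (dotvC b a); ring.
Qed.

(** Otherwise moving the minimizer along [Phi^T r] restricted to [I] would
    decrease the residual to first order. *)
Lemma least_squares_orthogonal (R : realType) (N d : nat)
    (Phi : 'M[R]_(N, d)) (x : 'cV[R]_N) (I : {set 'I_d}) (y : 'cV[R]_d) :
  is_least_squares Phi x I y ->
  restr I (Phi^T *m (x - Phi *m y)) = 0.
Proof.
case=> yI ymin; set r := x - _; set g := restr I _.
have gI : supp g \subset I := supp_restr _ _.
set G := l2norm g ^+ 2; set Q := l2norm (Phi *m g) ^+ 2.
have G0 : 0 <= G by apply: sqr_ge0.
have Q0 : 0 <= Q by apply: sqr_ge0.
have step t : 2 * t * G <= t ^+ 2 * Q.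
  have := ymin _ (suppD yI (suppZ t gI)).
  rewrite mulmxDr opprD addrA -/r -scalemxAr l2norm_le.
  rewrite sqr_l2normBZ -dotv_adj dotv_restr -/g -/G -/Q; lra.
(* This choice of the step length also covers [Phi g = 0]. *)
pose z := G / (Q + 1).
have Gz : G = z * (Q + 1) by rewrite /z divfK // gt_eqF //; lra.
have z0 : z = 0.
  have z20 := sqr_ge0 z; have zQ : 0 <= z ^+ 2 * Q by rewrite mulr_ge0.
  apply/eqP; rewrite -sqrf_eq0 eq_le z20 andbT.
  by have := step z; rewrite Gz; lra.
by apply/l2norm_eq0/eqP; rewrite -sqrf_eq0 -/G Gz z0 mul0r.
Qed.

(** The observation is close to [w - y] on [I] and vanishes there, so [w - y]
    is small on [I]; outside [I], which supports [y], it is [w]. The same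
    estimate serves inside an iteration and for the final output. *)
Lemma error_le_missing (R : realType) (N d m : nat) (Phi : 'M[R]_(N, d))
    (eps : R) (I : {set 'I_d}) (w y : 'cV[R]_d) (x e : 'cV[R]_N) :
  RIC Phi m eps -> (#|I :|: supp w| <= m)%N -> x = Phi *m w + e ->
  is_least_squares Phi x I y ->
  l2norm (w - y) <= l2norm (restr (~: I) w)
    + (2 * eps + eps ^+ 2) * l2norm (w - y) + (1 + eps) * l2norm e.
Proof.
move=> hPhi Dm xE ls; have yI := ls.1.
have hD : supp (w - y) \subset I :|: supp w.
  by apply: suppB; [exact: subsetUr | exact: subset_trans yI (subsetUl _ _)].
have := observation_local e hPhi Dm hD (subsetUl I (supp w)).
have -> : Phi *m (w - y) + e = x - Phi *m y.
  by rewrite xE mulmxBr addrAC.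
rewrite restrB (least_squares_orthogonal ls) sub0r l2normN => hI.
have wC : restr (~: I) (w - y) = restr (~: I) w.
  apply: restr_eq => i; rewrite inE => iI; rewrite !mxE.
  by rewrite (notin_supp yI iI) subr0.
have := l2norm_triangle (restr I (w - y)) (restr (~: I) (w - y)).
by rewrite -restr_splitC wC; lra.
Qed.

(** * Largest coordinates *)

(** Sum the pointwise inequality over all pairs of an element of [A] and one of
    [B]. *)
Lemma sum_le_card (R : realType) (T : finType) (A B : {set T}) (f g : T -> R)
    (c : R) :
  (#|A| <= #|B|)%N -> (forall j, j \in B -> 0 <= g j) -> 0 <= c ->
  (forall i j, i \in A -> j \in B -> f i <= c * g j) ->
  \sum_(i in A) f i <= c * \sum_(j in B) g j.
Proof.
move=> AB g0 c0 fg.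
have [B0|Bpos] := posnP #|B|.
  move: AB; rewrite B0 leqn0 cards_eq0 => /eqP->; rewrite big_set0.
  by rewrite mulr_ge0 // sumr_ge0.
have bp : 0 < (#|B|)%:R :> R by rewrite ltr0n.
rewrite -(ler_pM2r bp).
have -> : (\sum_(i in A) f i) * #|B|%:R = \sum_(i in A) \sum_(j in B) f i.
  by rewrite mulr_suml; apply: eq_bigr => i _; rewrite sumr_const mulr_natr.
apply: (@le_trans _ _ (\sum_(i in A) \sum_(j in B) c * g j)).
  by apply: ler_sum => i iA; apply: ler_sum => j jB; apply: fg.
rewrite sumr_const -mulr_sumr -(mulr_natr _ #|A|).
by apply: ler_wpM2l; rewrite ?ler_nat // mulr_ge0 // sumr_ge0.
Qed.

Lemma is_largest_full (R : realType) (d m : nat) (u : 'cV[R]_d)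
    (A S : {set 'I_d}) :
  is_largest m u A S -> (#|S| < m)%N -> S = A.
Proof.
case=> SA cS _ Sm; apply/eqP; rewrite eqEcard SA cS.
by move: Sm; rewrite cS gtn_min ltnn /= => /ltnW/minn_idPr ->.
Qed.

(** Exchange: the elements of [B] outside [S] are at most as many as those of
    [S] outside [B], and none is larger. A general monotone [f] serves both the
    squares and the absolute values. *)
Lemma is_largest_sum (R : realType) (d m : nat) (u : 'cV[R]_d)
    (A S B : {set 'I_d}) (f : 'I_d -> R) :
  is_largest m u A S -> B \subset A -> (#|B| <= m)%N ->
  (forall i, 0 <= f i) ->
  (forall i j, `|u i 0| <= `|u j 0| -> f i <= f j) ->
  \sum_(i in B) f i <= \sum_(i in S) f i.
Proof.
move=> lS BA Bm f0 fmono; have [SA cS big] := lS.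
rewrite (big_setID S) (big_setID B (A := S)) /= setIC lerD2l.
rewrite -[X in _ <= X]mul1r.
have [SltM|MleS] := ltnP #|S| m.
  have -> : B :\: S = set0.
    by apply/eqP; rewrite setD_eq0 (is_largest_full lS SltM).
  by rewrite big_set0 mul1r sumr_ge0.
apply: sum_le_card => //.
  rewrite -(leq_add2l #|B :&: S|) cardsID setIC cardsID.
  exact: leq_trans Bm MleS.
move=> i j; rewrite !inE => /andP[iS iB] /andP[_ jS].
rewrite mul1r fmono // big // inE iS; exact: (subsetP BA).
Qed.

(** * Regularization *)

(** Halving: the coordinates above [M / 2] are comparable, hence contribute at
    most [E], and the others satisfy the bound [M / 2]. The term
    in [#|J|] accounts for what is left after [K] halvings. *)
Lemma comparable_halving (R : realType) (d : nat) (u : 'cV[R]_d) (E : R)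
    (K : nat) (J : {set 'I_d}) (M : R) :
  (forall L : {set 'I_d}, L \subset J -> comparable_coords u L ->
     \sum_(i in L) u i 0 ^+ 2 <= E) ->
  (forall i, i \in J -> `|u i 0| <= M) ->
  \sum_(i in J) u i 0 ^+ 2 <= K%:R * E + #|J|%:R * (M / 2 ^+ K) ^+ 2.
Proof.
elim: K J M => [|K IH] J M hE hM.
  rewrite mul0r add0r expr0 divr1 mulr_natl -sumr_const.
  apply: ler_sum => i /hM h; rewrite -(real_normK (num_real (u i 0))).
  by rewrite ler_sqr ?nnegrE // (le_trans _ h).
pose L := [set i in J | M / 2 < `|u i 0|].
have LJ : L \subset J by apply/subsetP => i; rewrite inE => /andP[].
have LE : \sum_(i in L) u i 0 ^+ 2 <= E.
  apply: hE => // i j; rewrite !inE => /andP[/hM hi _] /andP[_ hj]; lra.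
rewrite (big_setID L) /= (setIidPr LJ).
have h : \sum_(i in J :\: L) u i 0 ^+ 2
    <= K%:R * E + #|J :\: L|%:R * (M / 2 / 2 ^+ K) ^+ 2.
  apply: IH.
    by move=> L' L'J; apply: hE; apply: subset_trans L'J (subsetDl _ _).
  move=> i; rewrite !inE => /andP[h iJ]; move: h; rewrite iJ /=.
  by rewrite -leNgt.
have c : #|J :\: L|%:R * (M / 2 / 2 ^+ K) ^+ 2
    <= #|J|%:R * (M / 2 / 2 ^+ K) ^+ 2 :> R.
  by apply: ler_wpM2r; rewrite ?sqr_ge0 // ler_nat subset_leq_card ?subsetDl.
have -> : M / 2 ^+ K.+1 = M / 2 / 2 ^+ K.
  by rewrite exprS invfM mulrA.
rewrite -[K.+1%:R]natr1 mulrDl mul1r; lra.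
Qed.

(** The largest coordinate of [J] alone is comparable, so its square is at most
    the energy of [J0]; this absorbs what is left after [K] halvings. *)
Lemma regularize_energy (R : realType) (d K : nat) (u : 'cV[R]_d)
    (J J0 : {set 'I_d}) :
  romp_regularize u J J0 -> (#|J| <= 4 ^ K)%N ->
  l2norm (restr J u) ^+ 2 <= K.+1%:R * l2norm (restr J0 u) ^+ 2.
Proof.
case=> J0J cJ0 maxJ0 JK; set E := l2norm (restr J0 u) ^+ 2.
have hE (L : {set 'I_d}) : L \subset J -> comparable_coords u L ->
    \sum_(i in L) u i 0 ^+ 2 <= E.
  move=> LJ cL; rewrite -sqr_l2norm_restr ler_sqr ?nnegrE ?l2norm_ge0 //.
  exact: maxJ0.
rewrite sqr_l2norm_restr.
have [J_0|[i0 i0J]] := set_0Vmem J.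
  by rewrite J_0 big_set0 mulr_ge0 ?sqr_ge0.
have [j jJ jmax] := arg_maxP (fun i => `|u i 0|) i0J.
apply: le_trans (comparable_halving K hE jmax) _.
rewrite -[K.+1%:R]natr1 mulrDl mul1r lerD2l.
have sj : [set j] \subset J by rewrite sub1set.
have : \sum_(i in [set j]) u i 0 ^+ 2 <= E.
  apply: hE => // a b; rewrite !inE => /eqP-> /eqP->.
  by have := normr_ge0 (u j 0); lra.
rewrite big_set1; apply: le_trans.
rewrite expr_div_n mulrCA -[X in _ <= X]mulr1 real_normK ?num_real //.
apply: ler_wpM2l; rewrite ?sqr_ge0 // ler_pdivrMr ?exprn_gt0 // mul1r.
by rewrite -exprM mulnC exprM -natrX -natrX ler_nat.
Qed.

(** The coordinates in [T] are no more numerous than the others and at most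
    twice as large, so they carry at most four times the energy. *)
Lemma comparable_energy_setD (R : realType) (d : nat) (u : 'cV[R]_d)
    (A T : {set 'I_d}) :
  comparable_coords u A -> (#|A :&: T| <= #|A :\: T|)%N ->
  l2norm (restr A u) ^+ 2 <= 5 * l2norm (restr (A :\: T) u) ^+ 2.
Proof.
move=> cA AT; rewrite !sqr_l2norm_restr (big_setID T) /=.
have : \sum_(i in A :&: T) u i 0 ^+ 2 <= 4 * \sum_(i in A :\: T) u i 0 ^+ 2.
  apply: sum_le_card => // [j _|i j]; first exact: sqr_ge0.
  rewrite !inE => /andP[iA _] /andP[_ jA].
  rewrite -(real_normK (num_real (u i 0))) -(real_normK (num_real (u j 0))).
  have -> : 4 * `|u j 0| ^+ 2 = (2 * `|u j 0|) ^+ 2 by rewrite exprMn; ring.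
  by rewrite ler_sqr ?nnegrE ?mulr_ge0 // cA.
lra.
Qed.

Lemma ln2_ge_half (R : realType) : 1 / 2 <= ln 2 :> R.
Proof.
have h : 2^-1 <= expR (- (1 / 2)) :> R.
  by apply: le_trans (expR_ge1Dx _); lra.
rewrite -[1 / 2]expRK ler_ln ?posrE ?expR_gt0 //.
rewrite -[expR _]invrK -expRN -[X in _ <= X]invrK lef_pV2 ?posrE ?expR_gt0 //.
by rewrite invr_gt0.
Qed.

(** With [t] the integer part of the base two logarithm of [s], take
    [K = t + 1]. Then [K + 1 <= 2 * t], as [s >= 4] gives [t >= 2], and
    [t <= 2 * ln s], as [ln 2 >= 1 / 2]. *)
Lemma log_number_of_blocks (R : realType) (s : nat) :
  (4 <= s)%N ->
  1 <= ln s%:R :> R /\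
  exists2 K, (s <= 4 ^ K)%N & K.+1%:R <= 4 * ln s%:R :> R.
Proof.
move=> s4; have sp : 0 < s%:R :> R by rewrite ltr0n; lia.
have l2 := ln2_ge_half R.
have lnge k : (2 ^ k <= s)%N -> k%:R * ln 2 <= ln s%:R :> R.
  move=> ks; rewrite mulr_natl -lnXn // ler_ln ?posrE ?exprn_gt0 //.
  by rewrite -natrX ler_nat.
split; first by have := lnge 2 s4; lra.
pose t := trunc_log 2 s; have s0 : (0 < s)%N by lia.
have /andP[tl tu] := @trunc_log_bounds 2 s isT s0.
exists t.+1.
  apply: ltnW; apply: leq_trans tu _.
  by rewrite -[4%N]/(2 ^ 2)%N -expnM leq_exp2l // -/t; lia.
have t2 : (2 <= t)%N by apply: trunc_log_max.
have : t.+2%:R <= 2 * t%:R :> R by rewrite -natrM ler_nat; lia.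
have := lnge t tl.
have : t%:R * (1 / 2) <= t%:R * ln 2 :> R by apply: ler_wpM2l.
lra.
Qed.

(** * One iteration of the pursuit *)

Lemma card_setU_mul (T : finType) (A B : {set T}) (a b s : nat) :
  (#|A| <= a * s)%N -> (#|B| <= b * s)%N -> (#|A :|: B| <= (a + b) * s)%N.
Proof.
move=> As Bs; apply: leq_trans (leq_card_setU A B) _.
by rewrite mulnDl leq_add.
Qed.

Lemma identify_energy (R : realType) (d s : nat) (u : 'cV[R]_d)
    (J A : {set 'I_d}) :
  romp_identify s u J -> (#|A| <= s)%N ->
  l2norm (restr A u) <= l2norm (restr J u).
Proof.
move=> lJ As; rewrite l2norm_le !sqr_l2norm_restr.
rewrite (big_setID (supp u)) /= [X in _ + X]big1 ?addr0; last first.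
  by move=> i; rewrite !inE negbK => /andP[/eqP-> _]; rewrite expr0n.
apply: (is_largest_sum lJ); first exact: subsetIr.
- exact: leq_trans (subset_leq_card (subsetIl _ _)) As.
- by move=> i; apply: sqr_ge0.
- move=> i j ij; rewrite -(real_normK (num_real (u i 0))).
  by rewrite -(real_normK (num_real (u j 0))) ler_sqr ?nnegrE.
Qed.

(** A coordinate already selected has a zero observation, while identification
    picks nonzero ones. *)
Lemma identify_disjoint (R : realType) (N d s : nat) (Phi : 'M[R]_(N, d))
    (x : 'cV[R]_N) (I J J0 : {set 'I_d}) (y : 'cV[R]_d) :
  is_least_squares Phi x I y ->
  romp_identify s (Phi^T *m (x - Phi *m y)) J ->
  J0 \subset J -> [disjoint I & J0].
Proof.
move=> ls [Ju _ _] J0J; rewrite disjoint_sym; apply/pred0P => i /=.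
apply/negP => /andP[iJ iI].
have := subsetP (subset_trans J0J Ju) i iJ; rewrite inE => /negP; apply.
have /colP/(_ i) := least_squares_orthogonal ls.
by rewrite [LHS]mxE iI [RHS]mxE => ->.
Qed.

(** The defect [2 * eps + eps ^+ 2] multiplies [|w - y|] in every estimate. The
    regularization loses a further factor of order [q], the root of the
    logarithm, and the product has to stay well below [1]. *)
Lemma RIC_defect_small (R : realType) (eps q : R) :
  0 < eps -> 1 <= q -> eps * q <= 1 / 50 ->
  [/\ eps <= 1 / 50, 0 <= 2 * eps + eps ^+ 2,
      2 * eps + eps ^+ 2 <= 101 / 2500 &
      q * (2 * eps + eps ^+ 2) <= 101 / 2500].
Proof.
move=> e0 q1 eq.
have h1 : eps <= eps * q by rewrite ler_peMr // ltW.
have h2 : eps <= 1 / 50 by lra.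
have h3 : eps * (eps * q) <= 1 / 50 * (eps * q).
  by apply: ler_wpM2r => //; rewrite mulr_ge0; lra.
have h4 : eps * eps <= 1 / 50 * eps by apply: ler_wpM2r; lra.
by rewrite expr2; split; try lra; have := mulr_ge0 (ltW e0) (ltW e0); lra.
Qed.

(** If at most half of the selected set [J0] lies in the support of [w], then
    its energy is comparable to that of [J0 :\: supp w]. This set avoids [I],
    so [w - y] vanishes on it and the observation is pure error. Since [J0]
    captures the norm of the observation on [J] up to the factor [2 * q], and
    [J] that of the missing part of the support, the missing part of [w] itself
    is of the order of the noise. *)
Lemma missing_part_small (R : realType) (N d s : nat) (Phi : 'M[R]_(N, d))
    (eps q : R) (I J J0 : {set 'I_d}) (w y : 'cV[R]_d) (x e : 'cV[R]_N) :
  RIC Phi (4 * s) eps -> 1 <= q -> eps * q <= 1 / 50 ->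
  (exists2 K, (s <= 4 ^ K)%N & K.+1%:R <= 4 * q ^+ 2) ->
  sparse s w -> (#|I| <= 2 * s)%N -> x = Phi *m w + e ->
  is_least_squares Phi x I y ->
  romp_identify s (Phi^T *m (x - Phi *m y)) J ->
  romp_regularize (Phi^T *m (x - Phi *m y)) J J0 ->
  (#|J0 :&: supp w| <= #|J0 :\: supp w|)%N ->
  l2norm (restr (~: I) w) <= 8 * q * l2norm e.
Proof.
move=> hPhi q1 epsq [K sK Kq] ws Is xE ls hJ hJ0 minor.
have [/andP[e0 _] _] := hPhi.
have [eps1 c0 c1 qc] := RIC_defect_small e0 q1 epsq.
have yI := ls.1; have [J0J cJ0 _] := hJ0.
have Js : (#|J| <= s)%N by case: hJ => _ -> _; apply: geq_minl.
have J0s : (#|J0| <= s)%N := leq_trans (subset_leq_card J0J) Js.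
have dis := identify_disjoint ls hJ J0J.
set u := Phi^T *m _ in hJ hJ0; set T := supp w.
have uE : u = Phi^T *m (Phi *m (w - y) + e).
  by congr (_ *m _); rewrite xE mulmxBr addrAC.
have IT : (#|I :|: T| <= 3 * s)%N.
  by apply: (card_setU_mul (a := 2) (b := 1)); rewrite ?mul1n.
have IT4 : (#|I :|: T| <= 4 * s)%N by rewrite (leq_trans IT) // leq_mul2r orbT.
have hIT : supp (w - y) \subset I :|: T.
  by apply: suppB; [exact: subsetUr | exact: subset_trans yI (subsetUl _ _)].
have error : l2norm (w - y) <= l2norm (restr (~: I) w)
    + (2 * eps + eps ^+ 2) * l2norm (w - y) + (1 + eps) * l2norm e.
  exact: (error_le_missing hPhi IT4 xE ls).
set c := 2 * eps + _ in c0 c1 qc error.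
pose eta := c * l2norm (w - y) + (1 + eps) * l2norm e.
have missing : l2norm (restr (~: I) w) <= l2norm (restr (T :\: I) u) + eta.
  have -> : restr (~: I) w
      = restr (T :\: I) u - restr (T :\: I) (u - (w - y)).
    rewrite restrB subKr; apply/colP => i; rewrite !mxE !inE.
    case: (boolP (i \in I)) => //= iI; have [-> //|_] := eqVneq (w i 0) 0.
    by rewrite (notin_supp yI iI) subr0.
  apply: le_trans (l2norm_triangleB _ _) _; rewrite lerD2l uE.
  apply: (observation_local e hPhi IT4 hIT).
  by apply: subset_trans (subsetDl _ _) (subsetUr _ _).
have noise : l2norm (restr (J0 :\: T) u) <= eta.
  have -> : restr (J0 :\: T) u = restr (J0 :\: T) (u - (w - y)).
    apply: restr_eq => i; rewrite inE => /andP[iT iJ0].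
    have iI : i \notin I by rewrite (disjointFl dis).
    rewrite [RHS]mxE [X in _ + X]mxE [(w - y) i 0]mxE [(- y) i 0]mxE.
    by rewrite (notin_supp (subxx T) iT) (notin_supp yI iI) !subr0.
  rewrite uE; apply: (observation_local (D := I :|: T :|: (J0 :\: T)) e hPhi).
  - apply: (card_setU_mul (a := 3) (b := 1) IT); rewrite mul1n.
    exact: leq_trans (subset_leq_card (subsetDl J0 T)) J0s.
  - exact: subset_trans hIT (subsetUl _ _).
  - exact: subsetUr.
have eta0 : 0 <= eta := le_trans (l2norm_ge0 _) noise.
have JE : l2norm (restr J u) <= 2 * q * l2norm (restr J0 u).
  rewrite -ler_sqr ?nnegrE ?mulr_ge0 ?l2norm_ge0 //; try lra.
  rewrite !exprMn; apply: le_trans (regularize_energy hJ0 _) _.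
    exact: leq_trans Js sK.
  by apply: ler_wpM2r; rewrite ?sqr_ge0 //; lra.
have J0E : l2norm (restr J0 u) <= 9 / 4 * l2norm (restr (J0 :\: T) u).
  rewrite -ler_sqr ?nnegrE ?mulr_ge0 ?l2norm_ge0 //; try lra.
  apply: le_trans (comparable_energy_setD cJ0 minor) _.
  by rewrite exprMn; apply: ler_wpM2r; rewrite ?sqr_ge0 //; lra.
have AE : l2norm (restr (T :\: I) u) <= l2norm (restr J u).
  apply: identify_energy hJ _.
  exact: leq_trans (subset_leq_card (subsetDl _ _)) ws.
(* The factor of [q] is twice the comparability loss [9 / 4], which bounds
   [sqrt 5]. *)
have loss : l2norm (restr (~: I) w) <= (1 + 9 / 2 * q) * eta.
  have : q * l2norm (restr J0 u) <= q * (9 / 4 * eta) by apply: ler_wpM2l; lra.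
  by move: missing; lra.
move: loss error; rewrite /eta.
have nh := l2norm_ge0 (w - y); have ne := l2norm_ge0 e.
set W := l2norm (restr _ w); set H := l2norm (w - y) in nh *.
set F := l2norm e in ne *.
have b1 : c * H <= 101 / 2500 * H by apply: ler_wpM2r.
have b2 : q * c * H <= 101 / 2500 * H by apply: ler_wpM2r.
have b3 : F <= q * F by rewrite ler_peMl.
have b4 : eps * F <= 1 / 50 * F by apply: ler_wpM2r.
have b5 : eps * (q * F) <= 1 / 50 * (q * F).
  by apply: ler_wpM2r => //; lra.
lra.
Qed.

(** * The whole run *)

Lemma least_squares_init (R : realType) (N d : nat) (Phi : 'M[R]_(N, d))
    (x : 'cV[R]_N) :
  is_least_squares Phi x set0 0.
Proof.
split=> [|z z0].
  by apply/subsetP => i; rewrite inE mxE eqxx.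
suff -> : z = 0 by [].
by apply/colP => i; rewrite mxE (notin_supp z0) ?inE.
Qed.

(** As long as the missing part of the support exceeds the noise, every
    iteration adds a set with a strict majority inside the support of [w]. Once
    it does not, this persists, since [I] only grows. *)
Lemma romp_invariant (R : realType) (N d s : nat) (Phi : 'M[R]_(N, d))
    (eps q : R) (w : 'cV[R]_d) (x e : 'cV[R]_N) (k : nat) (I : {set 'I_d})
    (y : 'cV[R]_d) (r : 'cV[R]_N) :
  RIC Phi (4 * s) eps -> 1 <= q -> eps * q <= 1 / 50 ->
  (exists2 K, (s <= 4 ^ K)%N & K.+1%:R <= 4 * q ^+ 2) ->
  sparse s w -> x = Phi *m w + e ->
  romp_state Phi x s k I y r ->
  [/\ is_least_squares Phi x I y, r = x - Phi *m y, (#|I| <= 3 * s)%N &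
      l2norm (restr (~: I) w) <= 8 * q * l2norm e \/
      (k <= #|I :&: supp w|)%N /\ (#|I| <= 2 * #|I :&: supp w|)%N].
Proof.
move=> hPhi q1 epsq hK ws xE.
elim=> [|{}k {}I J J0 {}y y' {}r _ [ls rE Is IH] ks I2s hJ hJ0 ls'].
  by split; [exact: least_squares_init | rewrite mulmx0 subr0
    | rewrite cards0 | right; rewrite set0I cards0].
rewrite {}rE in hJ hJ0; have [J0J _ _] := hJ0.
have J0s : (#|J0| <= s)%N.
  apply: leq_trans (subset_leq_card J0J) _.
  by case: hJ => _ -> _; apply: geq_minl.
split=> //.
  by apply: (card_setU_mul (a := 2) (b := 1)); rewrite ?mul1n // ltnW.
have persist : l2norm (restr (~: I) w) <= 8 * q * l2norm e ->
    l2norm (restr (~: (I :|: J0)) w) <= 8 * q * l2norm e.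
  by apply: le_trans; rewrite l2norm_restr_subset // setCS subsetUl.
have [minor|major] := leqP #|J0 :&: supp w| #|J0 :\: supp w|.
  left; apply: persist.
  exact: (missing_part_small hPhi q1 epsq hK ws (ltnW I2s) xE ls hJ hJ0 minor).
case: IH => [small|[kI I2]]; [by left; exact: persist | right].
have /eqP IJ0 : I :&: J0 == set0.
  by rewrite setI_eq0 (identify_disjoint ls hJ J0J).
have := cardsID (supp w) J0.
rewrite setIUl !cardsU IJ0 setIACA IJ0 set0I cards0 !subn0.
clear -kI I2 major; lia.
Qed.

(** When the run stops with a majority of correct indices throughout, [I]
    contains the support of [w] and nothing is missing. *)
Lemma romp_error (R : realType) (N d s : nat) (Phi : 'M[R]_(N, d))
    (eps q : R) (w vhat : 'cV[R]_d) (x e : 'cV[R]_N) (I : {set 'I_d}) :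
  RIC Phi (4 * s) eps -> 1 <= q -> eps * q <= 1 / 50 ->
  (exists2 K, (s <= 4 ^ K)%N & K.+1%:R <= 4 * q ^+ 2) ->
  sparse s w -> x = Phi *m w + e ->
  romp_output Phi x s I vhat ->
  l2norm (w - vhat) <= 10 * q * l2norm e.
Proof.
move=> hPhi q1 epsq hK ws xE [k [r [st stop]]].
have [ls _ I3 good] := romp_invariant hPhi q1 epsq hK ws xE st.
have ne := l2norm_ge0 e; have nh := l2norm_ge0 (w - vhat).
have F : l2norm e <= q * l2norm e by rewrite ler_peMl.
have small : l2norm (restr (~: I) w) <= 8 * q * l2norm e.
  case: good => // -[kI I2].
  have sI : supp w \subset I.
    apply/setIidPr/eqP; rewrite eqEcard subsetIr /=.
    apply: leq_trans ws _; case: stop => [<- //|I2s].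
    by rewrite -(leq_pmul2l (isT : 0 < 2)%N) (leq_trans I2s).
  have -> : restr (~: I) w = 0.
    apply/colP => i; rewrite !mxE inE; case: ifP => // iI.
    exact: (notin_supp sI iI).
  by rewrite l2norm0; lra.
have IT : (#|I :|: supp w| <= 4 * s)%N.
  by apply: (card_setU_mul (a := 3) (b := 1)); rewrite ?mul1n.
have := error_le_missing hPhi IT xE ls.
have [/andP[e0 _] _] := hPhi.
have [eps1 _ c1 _] := RIC_defect_small e0 q1 epsq.
set c := 2 * eps + _ in c1 *.
have b1 : c * l2norm (w - vhat) <= 101 / 2500 * l2norm (w - vhat).
  by apply: ler_wpM2r.
have b4 : eps * l2norm e <= 1 / 50 * l2norm e by apply: ler_wpM2r.
lra.
Qed.

(** * Tails of best sparse approximations *)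

Lemma exists_largest (R : realType) (d m : nat) (u : 'cV[R]_d)
    (A : {set 'I_d}) :
  exists S, is_largest m u A S.
Proof.
pose ge i j := `|u j 0| <= `|u i 0|.
have ge_tr : transitive ge by move=> j i k ij jk; apply: le_trans jk ij.
have ge_tot : total ge by move=> i j; apply: le_total.
(* The first [m] entries of [A] sorted by decreasing magnitude. *)
pose t := sort ge (enum A).
have tA : t =i A by move=> i; rewrite mem_sort mem_enum.
have tu : uniq t by rewrite sort_uniq enum_uniq.
have tsz : size t = #|A| by rewrite size_sort -cardE.
exists [set i in take m t]; split.
- by apply/subsetP => i; rewrite inE => /mem_take; rewrite tA.
- rewrite cardsE; have /card_uniqP-> : uniq (take m t) by apply: take_uniq.
  by rewrite size_take_min tsz.
- move=> i j; rewrite !inE -(tA j) => iS /andP[jS jt].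
  have jD : j \in drop m t.
    by move: jt; rewrite -{1}(cat_take_drop m t) mem_cat (negPf jS).
  have := sort_sorted ge_tot (enum A); rewrite -/t (sorted_pairwise ge_tr).
  rewrite -(cat_take_drop m t) pairwise_cat => /and3P[/allrelP h _ _].
  exact: h.
Qed.

Lemma l2norm_flat (R : realType) (d m : nat) (a : 'cV[R]_d) (M : R) :
  sparse m a -> 0 <= M -> (forall i, `|a i 0| <= M) ->
  l2norm a <= Num.sqrt m%:R * M.
Proof.
move=> am M0 aM.
rewrite -ler_sqr ?nnegrE ?mulr_ge0 ?l2norm_ge0 ?sqrtr_ge0 //.
rewrite exprMn (sqr_sqrtr (ler0n R m)) -(restrT a) sqr_l2norm_restr.
rewrite (big_setID (supp a)) /= [X in _ + X]big1 ?addr0; last first.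
  by move=> i; rewrite !inE andbT negbK => /eqP->; rewrite expr0n.
rewrite setTI; apply: (@le_trans _ _ (\sum_(i in supp a) M ^+ 2)).
  apply: ler_sum => i _; rewrite -(real_normK (num_real (a i 0))).
  by rewrite ler_sqr ?nnegrE.
rewrite sumr_const -(mulr_natl _ #|supp a|).
by apply: ler_wpM2r; rewrite ?sqr_ge0 // ler_nat.
Qed.

Lemma l1norm_restr (R : realType) (d : nat) (A : {set 'I_d}) (a : 'cV[R]_d) :
  l1norm (restr A a) = \sum_(i in A) `|a i 0|.
Proof.
rewrite [RHS]big_mkcond; apply: eq_bigr => i _; rewrite mxE.
by case: ifP => // _; rewrite normr0.
Qed.

Lemma l1norm_splitC (R : realType) (d : nat) (A : {set 'I_d})
    (a : 'cV[R]_d) :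
  l1norm a = l1norm (restr A a) + l1norm (restr (~: A) a).
Proof.
rewrite !l1norm_restr -[in LHS](restrT a) l1norm_restr (big_setID A) /=.
by rewrite setTI setTD.
Qed.

Lemma l1norm_ge0 (R : realType) (d : nat) (a : 'cV[R]_d) : 0 <= l1norm a.
Proof. by apply: sumr_ge0 => i _; apply: normr_ge0. Qed.

(** Peel off blocks of [m] largest coordinates. Every coordinate after a block
    is at most the average over that block, so the Euclidean norm of the next
    block is at most the [l1] norm of this one divided by [sqrt m], and these
    quotients add up. *)
Lemma RIC_bounded (R : realType) (N d m : nat) (Phi : 'M[R]_(N, d)) (eps : R)
    (z : 'cV[R]_d) (M : R) :
  RIC Phi m eps -> (0 < m)%N -> 0 <= M -> (forall i, `|z i 0| <= M) ->
  l2norm (Phi *m z)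
    <= (1 + eps) * (Num.sqrt m%:R * M + l1norm z / Num.sqrt m%:R).
Proof.
move=> hPhi m0; have [/andP[e0 _] hP] := hPhi.
have sm0 : 0 < Num.sqrt m%:R :> R by rewrite sqrtr_gt0 ltr0n.
have flat (a : 'cV[R]_d) K : sparse m a -> 0 <= K ->
    (forall i, `|a i 0| <= K) ->
    l2norm (Phi *m a) <= (1 + eps) * (Num.sqrt m%:R * K).
  move=> am K0 aK; have /andP[_ h] := hP a am; apply: le_trans h _.
  by apply: ler_wpM2l; [lra | exact: l2norm_flat].
have [c] := ubnP #|supp z|; elim: c => // c IH in z M *.
rewrite ltnS => zc M0 zM.
have [zm|mz] := leqP #|supp z| m.
  apply: le_trans (flat z M zm M0 zM) _.
  by apply: ler_wpM2l; [lra | rewrite lerDl divr_ge0 ?l1norm_ge0 ?ltW].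
have [S [SA cS big]] := exists_largest m z (supp z).
have {}cS : #|S| = m by rewrite cS; apply/minn_idPl/ltnW.
have restrM (A : {set 'I_d}) i : `|restr A z i 0| <= M.
  by rewrite mxE; case: ifP; rewrite ?normr0.
rewrite (restr_splitC S z) mulmxDr -restr_splitC (l1norm_splitC S z).
apply: le_trans (l2norm_triangle _ _) _.
have top : l2norm (Phi *m restr S z) <= (1 + eps) * (Num.sqrt m%:R * M).
  by apply: flat => //; apply: subset_sparse (supp_restr S z) _; rewrite cS.
(* The average magnitude over the block bounds all remaining coordinates. *)
pose M' := l1norm (restr S z) / m%:R.
have M'0 : 0 <= M' by rewrite divr_ge0 ?l1norm_ge0.
have rest : l2norm (Phi *m restr (~: S) z)
    <= (1 + eps) * (Num.sqrt m%:R * M'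
         + l1norm (restr (~: S) z) / Num.sqrt m%:R).
  apply: IH => //.
    apply: leq_trans zc; apply: proper_card; rewrite properE; apply/andP; split.
      apply/subsetP => i; rewrite !inE mxE; case: ifP => // _.
      by rewrite eqxx.
    have [i iS] : exists i, i \in S by apply/card_gt0P; rewrite cS.
    apply/subsetPn; exists i; first exact: (subsetP SA).
    by rewrite inE mxE inE iS /= eqxx.
  move=> i; rewrite mxE inE; have [iS|iS] := boolP (i \in S).
    by rewrite normr0.
  rewrite /= ler_pdivlMr ?ltr0n // l1norm_restr mulr_natr -[in X in _ *+ X]cS.
  rewrite -sumr_const; apply: ler_sum => j jS.
  have [->|zi] := eqVneq (z i 0) 0; first by rewrite normr0.
  by apply: big => //; rewrite !inE iS zi.
have M'E : Num.sqrt m%:R * M' = l1norm (restr S z) / Num.sqrt m%:R.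
  rewrite /M' -{2}(sqr_sqrtr (ler0n R m)); field; exact: lt0r_neq0.
rewrite M'E in rest; rewrite mulrDl; lra.
Qed.

Lemma best_sparse_l1tail (R : realType) (d n : nat) (v vn v2n : 'cV[R]_d) :
  is_best_sparse n v vn -> is_best_sparse (2 * n) v v2n ->
  l1norm (v - v2n) <= l1norm (v - vn).
Proof.
move=> [S1 [_ c1 _] ->] [S2 l2 ->]; rewrite !restr_subC.
have S1n : (#|S1| <= 2 * n)%N.
  by rewrite c1; apply: leq_trans (geq_minl _ _) _; rewrite leq_pmull.
have := is_largest_sum l2 (subsetT S1) S1n (fun i => normr_ge0 (v i 0))
  (fun i j h => h).
rewrite -!l1norm_restr.
have := l1norm_splitC S1 v; have := l1norm_splitC S2 v; lra.
Qed.

(** The [2 * n] largest coordinates contain [n] outside any set of [n], hence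
    the average of these bounds every coordinate left over. *)
Lemma best_sparse_suptail (R : realType) (d n : nat) (v vn v2n : 'cV[R]_d) :
  (0 < n)%N -> is_best_sparse n v vn -> is_best_sparse (2 * n) v v2n ->
  forall i, `|(v - v2n) i 0| <= l1norm (v - vn) / n%:R.
Proof.
move=> n0 [S1 [_ c1 _] ->] [S2 l2 ->] i; rewrite !restr_subC.
rewrite mxE inE; have [iS|iS] := boolP (i \in S2).
  by rewrite normr0 divr_ge0 ?l1norm_ge0.
rewrite /= ler_pdivlMr ?ltr0n // mulr_natr l1norm_restr.
have S2n : (2 * n <= #|S2|)%N.
  by rewrite leqNgt; apply: contra iS => /(is_largest_full l2) ->; rewrite inE.
have S21 : (n <= #|S2 :\: S1|)%N.
  have h1 : (#|S2 :&: S1| <= n)%N.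
    apply: leq_trans (subset_leq_card (subsetIr _ _)) _.
    by rewrite c1 geq_minl.
  rewrite -(leq_add2l #|S2 :&: S1|) cardsID; apply: leq_trans S2n.
  by rewrite mul2n -addnn leq_add2r.
apply: (@le_trans _ _ (\sum_(j in S2 :\: S1) `|v i 0|)).
  by rewrite sumr_const; apply: ler_wpMn2l.
apply: (@le_trans _ _ (\sum_(j in S2 :\: S1) `|v j 0|)).
  apply: ler_sum => j; rewrite inE => /andP[_ jS].
  by have [_ _ big] := l2; apply: big => //; rewrite !inE iS.
rewrite [X in _ <= X](big_setID S2) /= setIC -setDE lerDl.
by apply: sumr_ge0.
Qed.

(** Outside [supp w] the error [z - w] is [z], and the energy of [z] off its
    [m] largest coordinates is the least possible. *)
Lemma best_sparse_optimal (R : realType) (d m : nat) (z zm w : 'cV[R]_d) :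
  is_best_sparse m z zm -> sparse m w -> l2norm (z - zm) <= l2norm (z - w).
Proof.
move=> [S lS ->] wm; rewrite restr_subC.
have zw : restr (~: supp w) z = restr (~: supp w) (z - w).
  apply: restr_eq => i; rewrite inE => iw.
  by rewrite mxE [X in _ + X]mxE (notin_supp (subxx _) iw) subr0.
apply: le_trans (l2norm_restr_le (~: supp w) (z - w)).
rewrite -zw l2norm_le !sqr_l2norm_restr.
have := is_largest_sum lS (subsetT (supp w)) wm (fun i => sqr_ge0 (z i 0)).
have mono i j : `|z i 0| <= `|z j 0| -> z i 0 ^+ 2 <= z j 0 ^+ 2.
  move=> ij; rewrite -(real_normK (num_real (z i 0))).
  by rewrite -(real_normK (num_real (z j 0))) ler_sqr ?nnegrE.
move=> /(_ mono).
have split (A : {set 'I_d}) : \sum_(i in A) z i 0 ^+ 2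
    + \sum_(i in ~: A) z i 0 ^+ 2 = \sum_(i in setT) z i 0 ^+ 2.
  by rewrite [RHS](big_setID A) /= setTI setTD.
have := split S; have := split (supp w); lra.
Qed.

(** * Stability of the pursuit *)

Lemma RIC_leq (R : realType) (N d m m' : nat) (Phi : 'M[R]_(N, d)) (eps : R) :
  (m' <= m)%N -> RIC Phi m eps -> RIC Phi m' eps.
Proof.
by move=> mm [e hP]; split=> // a am; apply: hP; apply: leq_trans am mm.
Qed.

Theorem corollary3p2 (R : realType) (N d n : nat) (Phi : 'M[R]_(N, d))
    (hn : (2 <= n)%N)
    (hPhi : RIC Phi (8 * n) ((1 / 100) / Num.sqrt (ln n%:R)))
    (v : 'cV[R]_d) (e x : 'cV[R]_N) (hx : x = Phi *m v + e)
    (I : {set 'I_d}) (vhat : 'cV[R]_d)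
    (hvhat : romp_output Phi x (2 * n) I vhat)
    (vn v2n vhat2n : 'cV[R]_d)
    (hvn : is_best_sparse n v vn)
    (hv2n : is_best_sparse (2 * n) v v2n)
    (hvhat2n : is_best_sparse (2 * n) vhat vhat2n) :
  l2norm (v2n - vhat2n) <=
    477 * Num.sqrt (ln (2 * n)%:R)
        * (l2norm e + l1norm (v - vn) / Num.sqrt n%:R).
Proof.
have n0 : (0 < n)%N by apply: leq_trans hn.
have [L1 [K sK KL]] := @log_number_of_blocks R (2 * n)
  (leq_mul (leqnn 2) hn).
set q := Num.sqrt (ln (2 * n)%:R).
have qL : q ^+ 2 = ln (2 * n)%:R by rewrite sqr_sqrtr //; lra.
have q1 : 1 <= q by rewrite -[1]sqrtr1 ler_sqrt //; lra.
have np : 0 < n%:R :> R by rewrite ltr0n.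
have ln2 : ln 2 <= ln n%:R :> R by rewrite ler_ln ?posrE // ler_nat.
have lnn : 1 / 2 <= ln n%:R :> R := le_trans (ln2_ge_half R) ln2.
have ln2n : ln (2 * n)%:R <= 2 * ln n%:R :> R.
  by rewrite natrM lnM ?posrE //; lra.
set p := Num.sqrt (ln n%:R) in hPhi *.
have pp : 0 < p by rewrite sqrtr_gt0; lra.
have qp : q <= 2 * p.
  rewrite -ler_sqr ?nnegrE ?mulr_ge0 ?sqrtr_ge0 // exprMn qL sqr_sqrtr; lra.
set eps := _ / p in hPhi *.
have [/andP[e0 _] _] := hPhi.
have epsq : eps * q <= 1 / 50.
  rewrite /eps mulrAC ler_pdivrMr //; lra.
have [eps1 _ _ _] := RIC_defect_small e0 q1 epsq.
have w2n : sparse (2 * n) v2n.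
  case: hv2n => S [_ cS _] ->; apply: subset_sparse (supp_restr S v) _.
  by rewrite cS geq_minl.
pose e' := Phi *m (v - v2n) + e.
have xE : x = Phi *m v2n + e'.
  by rewrite hx /e' mulmxBr addrA subrKC.
have hPhi' : RIC Phi (4 * (2 * n)) eps by rewrite mulnA.
have err : l2norm (v2n - vhat) <= 10 * q * l2norm e'.
  apply: (romp_error hPhi' q1 epsq _ w2n xE hvhat); exists K => //.
  by rewrite qL.
set Y := l1norm (v - vn) / Num.sqrt n%:R.
have sn : 0 < Num.sqrt n%:R :> R by rewrite sqrtr_gt0.
have Y0 : 0 <= Y by rewrite divr_ge0 ?l1norm_ge0 // ltW.
have tail : l2norm (Phi *m (v - v2n)) <= (1 + eps) * (Y + Y).
  have hPhin : RIC Phi n eps by apply: RIC_leq hPhi; rewrite leq_pmull.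
  have M0 : 0 <= l1norm (v - vn) / n%:R by rewrite divr_ge0 ?l1norm_ge0.
  apply: le_trans (RIC_bounded hPhin n0 M0 (best_sparse_suptail n0 hvn hv2n)) _.
  apply: ler_wpM2l; first lra.
  apply: lerD; last first.
    by apply: ler_wpM2r (best_sparse_l1tail hvn hv2n); rewrite invr_ge0 ltW.
  rewrite /Y -{2}(sqr_sqrtr (ler0n R n)) le_eqVlt; apply/orP; left; apply/eqP.
  by field; exact: lt0r_neq0.
have noise : l2norm e' <= l2norm e + 102 / 50 * Y.
  apply: le_trans (l2norm_triangle _ _) _.
  have : eps * Y <= 1 / 50 * Y by apply: ler_wpM2r.
  by move: tail; lra.
(* The vector [v2n] competes with [vhat2n] among sparse approximations. *)
have half : l2norm (vhat - vhat2n) <= l2norm (v2n - vhat).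
  by rewrite -(l2normN (v2n - vhat)) opprB; apply: best_sparse_optimal w2n.
have : l2norm (v2n - vhat2n) <= l2norm (v2n - vhat) + l2norm (vhat - vhat2n).
  by rewrite -[v2n - vhat2n](subrKA vhat) l2norm_triangle.
have qe' : q * l2norm e' <= q * (l2norm e + 102 / 50 * Y).
  by apply: ler_wpM2l; lra.
have qY : 0 <= q * Y by rewrite mulr_ge0 //; lra.
have qe : 0 <= q * l2norm e by rewrite mulr_ge0 ?l2norm_ge0 //; lra.
lra.
Qed.
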